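(* Let $K$ be a field. Then the class of groups of $K$-linear Markov type is closed under the operations of taking subgroups, quotients, and extensions by finite or cyclic groups. That is: if $G$ is of $K$-linear Markov type, then so are every subgroup of $G$ and every quotient $G/N$ by a normal subgroup $N$; and if $G$ is a group with a normal subgroup $H$ of $K$-linear Markov type such that $G/H$ is finite or cyclic, then $G$ is of $K$-linear Markov type.
   Context: For a finite-dimensional $K$-vector space $A$, $A^G$ is the $K$-vector space of all maps $x \colon G \to A$, equipped with the prodiscrete topology (product topology with each factor $A$ discrete) and with the shift action $(gx)(h) = x(g^{-1}h)$. A linear subshift of $A^G$ is a closed $G$-invariant vector subspace of $A^G$. A subset $\Sigma \subset A^G$ is a subshift of finite type (SFT) if there exist a finite subset $D \subset G$ and a subset $P \subset A^D$ such that $\Sigma = \{x \in A^G : (g^{-1}x)|_D \in P \text{ for all } g \in G\}$. A group $G$ is of $K$-linear Markov type if, for every finite-dimensional vector space $A$ over $K$, every linear subshift $\Sigma \subset A^G$ is an SFT. *)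

(* Defs.v *)
From HB Require Import structures.
From mathcomp Require Import all_boot all_order all_algebra.
From mathcomp Require Import all_classical topology.

Set Implicit Arguments.
Unset Strict Implicit.
Unset Printing Implicit Defensive.

Import GRing.Theory.
Local Open Scope classical_set_scope.
Local Open Scope ring_scope.
Local Open Scope group_scope.
Local Open Scope quotient_scope.

(* G ranges over arbitrary, possibly infinite groups. The membership         *)
(* predicate of a [groupClosed G] is boolean, which is no restriction         *)
(* classically.                                                               *)
Definition subgroup (G : groupType) (H : groupClosed G) : Type :=
  {x : G | x \in H}.

Section Subgroup.
Variables (G : groupType) (H : groupClosed G).

Lemma subgroup_closed : group_closed (fun x : G => x \in H).
Proof. by split; [exact: gpred1 | exact: gpredF]. Qed.

HB.instance Definition _ := SubChoice.on (subgroup H).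
HB.instance Definition _ := SubChoice_isSubGroup.Build G (fun x : G => x \in H)
  (subgroup H) subgroup_closed.

End Subgroup.

Definition normal_subgroup (G : groupType) (N : groupClosed G) : Prop :=
  forall x g : G, x \in N -> x ^ g \in N.

Section CosetRelation.
Variables (G : groupType) (N : groupClosed G).

Definition coset_rel : rel G := fun x y => x^-1 * y \in N.

Lemma coset_rel_refl : reflexive coset_rel.
Proof. by move=> x; rewrite /coset_rel mulVg gpred1. Qed.

Lemma coset_rel_sym : symmetric coset_rel.
Proof. by move=> x y; rewrite /coset_rel -gpredV invgM invgK. Qed.

Lemma coset_rel_trans : transitive coset_rel.
Proof.
move=> y x z xy yz; rewrite /coset_rel.
by rewrite -[z](mulVKg y) mulgA; apply: gpredM.
Qed.

Canonical coset_equiv :=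
  EquivRel coset_rel coset_rel_refl coset_rel_sym coset_rel_trans.

End CosetRelation.

Definition quotient_group (G : groupType) (N : groupClosed G)
  (nN : normal_subgroup N) : Type := {eq_quot (coset_rel N)}.

Section QuotientGroup.
Variables (G : groupType) (N : groupClosed G) (nN : normal_subgroup N).

Local Notation Q := (quotient_group nN).

HB.instance Definition _ := Choice.on Q.
HB.instance Definition _ := EqQuotient.on Q.

Definition quotg_mul (u v : Q) : Q := \pi_Q (repr u * repr v).
Definition quotg_inv (u : Q) : Q := \pi_Q (repr u)^-1.
Definition quotg_one : Q := \pi_Q 1.

Lemma eq_quotg (x y : G) : (\pi_Q x = \pi_Q y) <-> (x^-1 * y \in N).
Proof. by split=> [/eqmodP|H]; [|apply/eqmodP]. Qed.

Lemma pi_quotgM (x y : G) : quotg_mul (\pi_Q x) (\pi_Q y) = \pi_Q (x * y).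
Proof.
apply/eq_quotg.
have /eq_quotg Hx : \pi_Q (repr (\pi_Q x)) = \pi_Q x by rewrite reprK.
have /eq_quotg Hy : \pi_Q (repr (\pi_Q y)) = \pi_Q y by rewrite reprK.
set a := repr _ in Hx *; set b := repr _ in Hy *.
have -> : (a * b)^-1 * (x * y) = (a^-1 * x) ^ b * (b^-1 * y).
  by rewrite conjgE invgM !mulgA mulgK.
by apply: gpredM => //; apply: nN.
Qed.

Lemma pi_quotgV (x : G) : quotg_inv (\pi_Q x) = \pi_Q x^-1.
Proof.
apply/eq_quotg.
have /eq_quotg Hx : \pi_Q (repr (\pi_Q x)) = \pi_Q x by rewrite reprK.
set a := repr _ in Hx *.
have -> : a^-1^-1 * x^-1 = ((a^-1 * x) ^ a^-1)^-1.
  by rewrite conjgE invgK -mulgA mulVKg invgM invgK.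
by rewrite gpredV; apply: nN.
Qed.

Lemma quotg_mulA : associative quotg_mul.
Proof.
elim/quotW=> x; elim/quotW=> y; elim/quotW=> z.
by rewrite (pi_quotgM y z) (pi_quotgM x y) !pi_quotgM mulgA.
Qed.

Lemma quotg_mul1 : left_id quotg_one quotg_mul.
Proof. by elim/quotW=> x; rewrite /quotg_one pi_quotgM mul1g. Qed.

Lemma quotg_mulg1 : right_id quotg_one quotg_mul.
Proof. by elim/quotW=> x; rewrite /quotg_one pi_quotgM mulg1. Qed.

Lemma quotg_mulV : left_inverse quotg_one quotg_inv quotg_mul.
Proof. by elim/quotW=> x; rewrite pi_quotgV pi_quotgM mulVg. Qed.

Lemma quotg_mulgV : right_inverse quotg_one quotg_inv quotg_mul.
Proof. by elim/quotW=> x; rewrite pi_quotgV pi_quotgM mulgV. Qed.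

HB.instance Definition _ := isGroup.Build Q
  quotg_mulA quotg_mul1 quotg_mulg1 quotg_mulV quotg_mulgV.

End QuotientGroup.

Definition finite_group (G : groupType) : Prop := finite_set [set: G].

(* The two disjuncts give the integral powers of g. *)
Definition cyclic_group (G : groupType) : Prop :=
  exists g : G, forall x : G, exists n : nat, x = g ^+ n \/ x = g ^- n.

Definition shift (G : groupType) (A : Type) (g : G) (x : G -> A) : G -> A :=
  fun h => x (g^-1 * h).

(* [{ptws _ -> discrete_topology _}] carries the prodiscrete topology, and  *)
(* [0], [+], [*:] are the pointwise operations on [G -> A].                 *)
Definition linear_subshift (K : fieldType) (A : vectType K) (G : groupType)
    (S : set (G -> A)) : Prop :=
  [/\ closed (S : set {ptws G -> discrete_topology A}),
      forall (g : G) (x : G -> A), S x -> S (shift g x),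
      S 0%R
    & forall (a : K) (x y : G -> A), S x -> S y -> S (a *: x + y)%R].

(* [sigL D x : D -> A] is the restriction of x to D. *)
Definition is_SFT (A : Type) (G : groupType) (S : set (G -> A)) : Prop :=
  exists (D : set G) (P : set (D -> A)), finite_set D /\
    S = [set x | forall g : G, P (sigL D (shift g^-1 x))].

Definition linear_markov_type (K : fieldType) (G : groupType) : Prop :=
  forall (A : vectType K) (S : set (G -> A)), linear_subshift S -> is_SFT S.

(* Main.v *)
Require Import Defs.
From mathcomp Require Import all_boot all_order all_algebra.
From mathcomp Require Import all_classical topology.

(** A linear subshift is an SFT iff it has a finite "window", so everything can
    be phrased with finite sets of coordinates. Subgroups are handled by
    imposing the subshift on every left coset, quotients by pulling back, and
    finite extensions by viewing [A^G] as [(A^T)^H] with [T] a transversal. For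
    a cyclic extension with [G/H] generated by [t], Hilbert's basis theorem is
    dualised: the subshifts [Y n] of the values on [H] of the configurations
    vanishing on [H t], ..., [H t^n] decrease, hence stabilise at some [N]; a
    window for the strip [H], [H t], ..., [H t^N] is then a window for the whole
    subshift, one more layer being filled in at each step. Linear compactness
    replaces the duality between subshifts and modules over the group ring. *)

Set Implicit Arguments.
Unset Strict Implicit.
Unset Printing Implicit Defensive.

Import GRing.Theory.
Local Open Scope classical_set_scope.
Local Open Scope ring_scope.
Local Open Scope group_scope.
Local Open Scope quotient_scope.

(** * Prodiscrete topology and windows *)

Definition adherent (I : eqType) (A : Type) (S : set (I -> A)) (x : I -> A) :=
  forall s : seq I, exists2 y, S y & {in s, y =1 x}.

Lemma nbhs_ptws_discreteP (I A : choiceType)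
    (x : {ptws I -> discrete_topology A})
    (B : set {ptws I -> discrete_topology A}) :
  nbhs x B <-> exists s : seq I,
    forall y : I -> A, {in s, y =1 (x : I -> A)} -> B y.
Proof.
split=> [|[s sB]].
  pose F := filter_from [set: seq I]
    (fun s => [set y : {ptws I -> discrete_topology A} | {in s, y =1 x}]).
  have FF : Filter F.
    apply: filter_from_filter; first by exists [::].
    move=> s t _ _; exists (s ++ t) => // y yst; split=> i ist;
      by apply: yst; rewrite mem_cat ist ?orbT.
  (* The product topology is the supremum of the coordinate topologies, so convergence of the
     cylinder filter [F] can be checked on one coordinate at a time. *)
  suff /[apply] : F --> x by case=> s _ sB; exists s.
  apply/cvg_sup => i W.
  rewrite (@nbhsE (initial_topology _)) => -[_ [[O _ <-] Ox] OW].
  by exists [:: i] => // y /(_ i (mem_head _ _)) yi; apply: OW; rewrite /= yi.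
have : nbhs x [set y : {ptws I -> discrete_topology A} | {in s, y =1 x}].
  elim: s {sB} => [|i s IHs]; first by apply: filterE => y j.
  have Hi : nbhs x [set y : {ptws I -> discrete_topology A} | y i = x i].
    exact: (@proj_continuous I (fun=> discrete_topology A) i x _
      (discrete_set1 (x i))).
  apply: filterS (filterI Hi IHs) => y [yi ys] j.
  by rewrite inE => /predU1P[->|/ys].
by apply: filterS => y /sB.
Qed.

Lemma closed_ptws_discreteP (I A : choiceType) (S : set (I -> A)) :
  closed (S : set {ptws I -> discrete_topology A}) <->
  (forall x, adherent S x -> S x).
Proof.
split=> [cS x ax|aS x xS].
  apply: cS => B /nbhs_ptws_discreteP[s sB].
  by have [y Sy ys] := ax s; exists y; split; last exact: sB.
apply: aS => s.
have [|y [Sy ys]] := xS [set y : I -> A | {in s, y =1 x}]; last by exists y.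
by apply/nbhs_ptws_discreteP; exists s.
Qed.

Definition is_window (G : groupType) (A : Type) (S : set (G -> A)) (s : seq G) :=
  forall x, (forall g, exists2 y, S y & {in s, y =1 shift g x}) -> S x.

Lemma shift1 (G : groupType) (A : Type) (x : G -> A) : shift 1 x = x.
Proof. by apply/funext => h; rewrite /shift invg1 mul1g. Qed.

Lemma shiftM (G : groupType) (A : Type) (g h : G) (x : G -> A) :
  shift (g * h) x = shift g (shift h x).
Proof. by apply/funext => k; rewrite /shift invgM mulgA. Qed.

(** Every defining pattern set contains the patterns occurring in [S]; conversely these patterns
    alone can serve as the pattern set. *)
Lemma is_SFT_windowP (G : groupType) (A : Type) (S : set (G -> A)) :
  (forall g x, S x -> S (shift g x)) ->
  is_SFT S <-> exists s, is_window S s.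
Proof.
move=> Sshift; split=> [[D [P [/finite_seqP[s Ds] SE]]]|[s sS]].
  exists s => x xS; rewrite SE => g; have [y + ys] := xS g^-1.
  rewrite SE => /(_ 1); rewrite invg1 shift1.
  suff -> : sigL D y = sigL D (shift g^-1 x) by [].
  apply/funext => -[d dD]; apply: ys.
  by have := set_mem dD; rewrite [X in X d]Ds.
exists [set` s], [set p | exists2 y, S y & sigL [set` s] y = p].
split; first exact: finite_seq.
apply/seteqP; split=> x /= => [Sx g|xS].
  by exists (shift g^-1 x) => //; exact: Sshift.
apply: sS => g; have [y Sy yx] := xS g^-1; exists y => // h hs.
have hs' : h \in [set` s] by rewrite inE.
by have := congr1 (@^~ (SigSub hs')) yx; rewrite /sigL invgK.
Qed.

Lemma linear_subshiftP (K : fieldType) (A : vectType K) (G : groupType)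
    (S : set (G -> A)) :
  linear_subshift S <->
  [/\ forall x, adherent S x -> S x,
      forall g x, S x -> S (shift g x),
      S 0%R
    & forall (a : K) x y, S x -> S y -> S (a *: x + y)%R].
Proof.
by split=> -[cS ? ? ?]; split=> //; apply/closed_ptws_discreteP.
Qed.

Lemma linear_markov_typeP (K : fieldType) (G : groupType) :
  linear_markov_type K G <->
  forall (A : vectType K) (S : set (G -> A)), linear_subshift S ->
    exists s, is_window S s.
Proof.
split=> GM A S SS; have [_ Sg _ _] := SS.
  exact/(is_SFT_windowP Sg)/GM.
exact/(is_SFT_windowP Sg)/GM.
Qed.

(** * Linear compactness *)

Definition linear_set (K : fieldType) (V : lmodType K) (U : set V) :=
  U 0%R /\ forall (a : K) u v, U u -> U v -> U (a *: u + v)%R.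

(** A subspace of maximal dimension inside [U] exhausts it, since adjoining a further vector of [U]
    would raise the dimension. *)
Lemma linear_set_vspace (K : fieldType) (V : vectType K) (U : set V) :
  linear_set U -> exists W : {vspace V}, forall v, v \in W <-> U v.
Proof.
move=> [U0 Ulin].
pose P d := `[< exists2 W : {vspace V}, \dim W = d & forall v, v \in W -> U v >].
have P0 : exists d, P d.
  exists 0%N; apply/asboolP; exists 0%VS; first exact: dimv0.
  by move=> v /[!memv0] /eqP->.
have Pmax d : P d -> (d <= \dim {: V})%N.
  by move=> /asboolP[W <- _]; apply/dimvS/subvf.
case: (ex_maxnP P0 Pmax) => d /asboolP[W Wd WU] maxd.
exists W => v; split=> [/WU//|Uv]; apply: contrapT => vW.
suff /maxd : P (\dim (W + <[v]>)%VS).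
  rewrite -Wd => dW; apply: vW.
  have /eqP -> : (W == W + <[v]>)%VS by rewrite eqEdim addvSl.
  exact: (subvP (addvSr _ _) _ (memv_line _)).
apply/asboolP; exists (W + <[v]>)%VS => // _ /memv_addP[w Ww [_ /vlineP[c ->] ->]].
by rewrite addrC; apply: Ulin => //; exact: WU.
Qed.

Lemma linear_set_minimal (K : fieldType) (V : vectType K) (F : set (set V)) :
  F !=set0 -> (forall U, F U -> linear_set U) ->
  exists2 U, F U & forall U', F U' -> U' `<=` U -> U `<=` U'.
Proof.
move=> [U0 FU0] Flin.
pose P d := `[< exists2 W : {vspace V}, \dim W = d & F [set v | v \in W] >].
have FE U : F U -> exists2 W : {vspace V}, U = [set v | v \in W] & P (\dim W).
  move=> FU; have [W WU] := linear_set_vspace (Flin _ FU).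
  have UE : U = [set v | v \in W] by apply/seteqP; split=> v /WU.
  by exists W => //; apply/asboolP; exists W; rewrite -?UE.
have exP : exists d, P d by have [W _ PW] := FE _ FU0; exists (\dim W).
case: (ex_minnP exP) => d /asboolP[W Wd FW] mind.
exists [set v | v \in W] => // U' /FE[W' -> /mind dW'] W'W v /=.
suff /eqP-> : W' == W by [].
by rewrite eqEdim Wd dW' andbT; apply/subvP.
Qed.

(* Linear compactness: by Zorn's lemma there is a maximal graph all of whose  *)
(* finite parts are met by every [C k]. It is everywhere defined, because at  *)
(* each point the admissible values form a directed family of nonempty affine *)
(* subspaces of A, and these have a smallest element.                         *)
Lemma linear_compactness (K : fieldType) (A : vectType K) (I : eqType)
    (T : Type) (k0 : T) (C : T -> set (I -> A)) :
  (forall j k, exists l, C l `<=` C j `&` C k) ->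
  (forall k, C k !=set0) ->
  (forall k (a : K) x y z, C k x -> C k y -> C k z ->
    C k (a *: (x - y) + z)%R) ->
  exists x, forall k, adherent (C k) x.
Proof.
move=> Cdir Cne Caff.
pose meets (s : seq (I * A)) (y : I -> A) := {in s, forall p, y p.1 = p.2}.
pose P (Q : set (I * A)) := forall k s, (forall p, p \in s -> Q p) ->
  exists2 y, C k y & meets s y.
have [] := @Zorn_bigcup _ P.
  move=> F FP Ftot k s sF.
  (* A finite part of the union of a chain lies in one member; the empty part is separate because
     the chain may be empty. *)
  have [s0|[Q FQ sQ]] : s = [::] \/ exists2 Q, F Q & forall p, p \in s -> Q p.
  - elim: s sF => [|p s IHs] sF; [by left|right].
    have [Q FQ Qp] := sF p (mem_head _ _).
    have [q qs|s0|[Q' FQ' sQ']] := IHs; first by apply: sF; rewrite inE qs orbT.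
      by exists Q => // q; rewrite s0 inE => /eqP->.
    have [QQ'|Q'Q] := Ftot _ _ FQ FQ'.
      by exists Q' => // q; rewrite inE => /predU1P[->|/sQ'//]; exact: QQ'.
    by exists Q => // q; rewrite inE => /predU1P[->//|/sQ']; exact: Q'Q.
  - by have [y Cy] := Cne k; exists y => // p; rewrite s0.
  - exact: FP FQ k s sQ.
move=> Q [PQ Qmax].
have Qtot i : exists a, Q (i, a).
  (* [dir k s] is the direction of the affine set of values at [i] taken by the elements of [C k]
     that fit [s]. *)
  pose dir k s := [set a : A | exists y z,
    [/\ C k y /\ meets s y, C k z /\ meets s z & a = (y i - z i)%R]].
  have meets_lin s a x y z : meets s x -> meets s y -> meets s z ->
      meets s (a *: (x - y) + z)%R.
    move=> xs ys zs p ps; rewrite !fctE (xs _ ps) (ys _ ps) (zs _ ps).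
    by rewrite subrr scaler0 add0r.
  have [] := @linear_set_minimal K A
    [set U | exists k s, (forall p, p \in s -> Q p) /\ U = dir k s].
  - by exists (dir k0 [::]), k0, [::]; split.
  - move=> _ [k [s [sQ ->]]]; split.
      by have [y Cy ys] := PQ k s sQ; exists y, y; split; rewrite ?subrr.
    move=> a _ _ [x [y [[Cx xs] [Cy ys] ->]]] [z [w [[Cz zs] [Cw ws] ->]]].
    exists (a *: (x - y) + z)%R, w; split=> //; last by rewrite !fctE addrA.
    by split; [exact: Caff|exact: meets_lin].
  move=> _ [k1 [s1 [s1Q ->]]] min1; have [y1 Cy1 y1s] := PQ k1 s1 s1Q.
  (* The direction is minimal, so refining the constraints does not shrink this affine set, and any
     of its values is admissible at [i]. *)
  exists (y1 i); apply: contrapT => Q1.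
  apply: (Qmax (Q `|` [set (i, y1 i)])).
    split=> [q|QQ1]; first by left.
    by apply/Q1/QQ1; right.
  move=> k s sQ.
  have [l + ] := Cdir k k1; rewrite subsetI => -[lk l1].
  pose s' := [seq p <- s | p != (i, y1 i)].
  have s'Q p : p \in s' ++ s1 -> Q p.
    rewrite mem_cat mem_filter => /orP[/andP[pi ps]|/s1Q//].
    by have [//|pE] := sQ p ps; rewrite pE eqxx in pi.
  have [y2 Cy2 y2s] := PQ l _ s'Q.
  have mcat t t' y : meets (t ++ t') y -> meets t y /\ meets t' y.
    by move=> yt; split=> p pt; apply: yt; rewrite mem_cat pt ?orbT.
  have [y2s' y2s1] := mcat _ _ _ y2s.
  have : dir k1 s1 (y1 i - y2 i)%R by exists y1, y2; split=> //; split=> //; exact: l1.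
  move=> /(min1 (dir l (s' ++ s1))) [].
  - by exists l, (s' ++ s1).
  - move=> _ [y [z [[Cy /mcat[_ ys]] [Cz /mcat[_ zs]] ->]]].
    by exists y, z; split=> //; split=> //; exact: l1.
  move=> y [z [[Cy ys] [Cz zs] yz]].
  (* Moving [y2] along the unchanged direction gives it the value [y1 i] at [i]. *)
  exists (1 *: (y - z) + y2)%R; first by apply/lk/Caff.
  move=> p ps; have [->|pi] := eqVneq p (i, y1 i).
    by rewrite /= !fctE scale1r -yz subrK.
  by apply: (meets_lin _ _ _ _ _ ys zs y2s); rewrite mem_cat mem_filter pi ps.
have [x xQ] := choice Qtot.
exists x => k s; have [|y Cy ys] := PQ k [seq (i, x i) | i <- s].
  by move=> _ /mapP[i _ ->].
by exists y => // i si; apply: (ys (i, x i)); apply: map_f.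
Qed.

(** * Descending chains of linear subshifts *)

Lemma window_shift (G : groupType) (A : Type) (S : set (G -> A)) (s : seq G) x :
  (forall g, exists2 y, S y & {in s, y =1 shift g x}) ->
  forall k g, exists2 y, S y & {in s, y =1 shift g (shift k x)}.
Proof. by move=> xS k g; rewrite -shiftM. Qed.

Lemma linear_subshiftB (K : fieldType) (A : vectType K) (G : groupType)
    (S : set (G -> A)) x y :
  linear_subshift S -> S x -> S y -> S (x - y)%R.
Proof.
by move=> [_ _ _ Slin] Sx Sy; rewrite addrC -scaleN1r; exact: Slin.
Qed.

Lemma linear_subshiftD (K : fieldType) (A : vectType K) (G : groupType)
    (S : set (G -> A)) x y :
  linear_subshift S -> S x -> S y -> S (x + y)%R.
Proof. by move=> [_ _ _ Slin] Sx Sy; rewrite -[x]scale1r; exact: Slin. Qed.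

Lemma linear_subshift_affine (K : fieldType) (A : vectType K) (G : groupType)
    (S : set (G -> A)) (a : K) x y z :
  linear_subshift S -> S x -> S y -> S z -> S (a *: (x - y) + z)%R.
Proof.
move=> SS Sx Sy Sz; have [_ _ _ Slin] := SS.
by apply: Slin => //; exact: linear_subshiftB.
Qed.

Lemma linear_subshift_adherent (K : fieldType) (A : vectType K) (G : groupType)
    (S : set (G -> A)) x :
  linear_subshift S -> adherent S x -> S x.
Proof. by move=> /linear_subshiftP[+ _ _ _]; exact. Qed.

(* The traces of the chain on a window of its intersection stabilise for      *)
(* dimension reasons, and compactness lifts the stable trace to the           *)
(* intersection.                                                              *)
Lemma linear_markov_dcc (K : fieldType) (G : groupType) (A : vectType K)
    (Y : nat -> set (G -> A)) :
  linear_markov_type K G -> (forall n, linear_subshift (Y n)) ->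
  (forall m n, (m <= n)%N -> Y n `<=` Y m) ->
  exists N, forall n, Y N `<=` Y n.
Proof.
move=> /linear_markov_typeP GM Ylin Ydec.
have YS : linear_subshift [set x | forall n, Y n x].
  apply/linear_subshiftP; split.
  - move=> x ax n; apply: linear_subshift_adherent => // s.
    by have [y Yy ys] := ax s; exists y.
  - by move=> g x Yx n; have [_ Yg _ _] := Ylin n; apply: Yg.
  - by move=> n; case: (Ylin n).
  - by move=> a x y Yx Yy n; have [_ _ _ Yl] := Ylin n; apply: Yl.
have [s sY] := GM _ _ YS.
pose tr (x : G -> A) : {ffun 'I_(size s) -> A} := [ffun i => x (tnth (in_tuple s) i)].
have trP x y : {in s, x =1 y} <-> tr x = tr y.
  split=> [xy|/ffunP xy _ /(tnthP (in_tuple s))[i ->]].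
    by apply/ffunP => i; rewrite !ffunE; apply: xy; exact: (mem_tnth i (in_tuple s)).
  by have := xy i; rewrite !ffunE.
have [] := @linear_set_minimal K {ffun 'I_(size s) -> A}
  [set U | exists n, U = tr @` Y n].
- by exists (tr @` Y 0), 0%N.
- move=> _ [n ->]; have [_ _ Y0 Yl] := Ylin n; split.
    by exists 0%R => //; apply/ffunP => i; rewrite !ffunE.
  move=> a _ _ [x Yx <-] [y Yy <-]; exists (a *: x + y)%R; first exact: Yl.
  by apply/ffunP => i; rewrite !ffunE !fctE.
move=> _ [N ->] minN; exists N => n x YNx; move: n; apply: sY => g.
have [_ YNg _ _] := Ylin N; have YNgx := YNg g x YNx.
have [] := @linear_compactness K A G nat 0
  (fun n => Y n `&` [set y : G -> A | {in s, y =1 shift g x}]).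
- move=> j k; exists (maxn j k) => y [Yy ys].
  by split; split=> //; apply: Ydec Yy; rewrite ?leq_maxl ?leq_maxr.
(* Minimality only concerns traces contained in that of [Y N], hence the index [maxn N n]. *)
- move=> n; have [|||y Yy /trP ys] := minN (tr @` Y (maxn N n)) _ _ (tr (shift g x)).
  + by exists (maxn N n).
  + by apply: image_subset; apply: Ydec; rewrite leq_maxl.
  + by exists (shift g x).
  exists y; split => //.
  by apply: Ydec Yy; rewrite leq_maxr.
- move=> n a y z w [Yy ys] [Yz zs] [Yw ws]; split.
    exact: linear_subshift_affine.
  by move=> i si; rewrite !fctE ys// zs// ws// subrr scaler0 add0r.
move=> y ay; exists y.
  move=> n; apply: linear_subshift_adherent => // t.
  by have [z [Yz _] zt] := ay n t; exists z.
by move=> i si; have [z [_ zs] <-//] := ay 0%N s; exact: zs.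
Qed.

(** * Extensions by finite and cyclic groups *)

Section Subgroup.
Variables (K : fieldType) (G : groupType) (H : groupClosed G).

Local Notation vH := (val : subgroup H -> G).

Lemma subgroup_val1 : vH 1 = 1. Proof. exact: val1. Qed.

Lemma subgroup_valM h k : vH (h * k) = vH h * vH k. Proof. exact: valM. Qed.

Lemma subgroup_valV h : vH h^-1 = (vH h)^-1.
Proof. by apply/eqP; rewrite -mulg_eq1 -subgroup_valM mulVg subgroup_val1. Qed.

Lemma normal_subgroup_swap (nH : normal_subgroup H) (g : G) h :
  exists h', g * vH h = vH h' * g.
Proof.
have hH : vH h ^ g^-1 \in H by apply: nH; exact: valP.
by exists (exist (fun x => x \in H) _ hH); rewrite /= conjgE invgK !mulgA mulgVK.
Qed.

(** The quotient is made of left cosets; normality moves the factor from [H] to the left. *)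
Lemma eq_quotg_val (nH : normal_subgroup H) (g k : G) :
  \pi_(quotient_group nH) g = \pi_(quotient_group nH) k ->
  exists h, g = vH h * k.
Proof.
move=> /esym/eq_quotg kgH.
have [h' hE] := normal_subgroup_swap nH k (exist (fun x => x \in H) _ kgH).
by exists h'; rewrite -hE /= mulVKg.
Qed.

(** Collecting the values at [h * t i], for all [i], into one vector turns the strip into a subshift
    over [H] with alphabet [A^r]. Requiring an element of [S] only on each finite [e] makes [ST]
    closed by construction. *)
Lemma linear_markov_strip_window (A : vectType K) (S : set (G -> A)) r
    (t : 'I_r -> G) :
  linear_markov_type K (subgroup H) -> linear_subshift S ->
  exists s : seq G, forall x,
    (forall g, exists2 y, S y & {in s, y =1 shift g x}) ->
    forall e : seq (subgroup H), exists2 z, S z &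
      {in e, forall h i, z (vH h * t i) = x (vH h * t i)}.
Proof.
move=> /linear_markov_typeP HM SS; have [_ Sg S0 Slin] := SS.
pose ST := [set u : subgroup H -> {ffun 'I_r -> A} |
  forall e : seq (subgroup H), exists2 z, S z &
    {in e, forall h i, z (vH h * t i) = u h i}].
have STS : linear_subshift ST.
  apply/linear_subshiftP; split.
  - move=> u au e; have [v STv ve] := au e; have [z Sz ze] := STv e.
    by exists z => // h he i; rewrite ze// ve.
  - move=> k u STu e; have [z Sz ze] := STu [seq k^-1 * h | h <- e].
    exists (shift (vH k) z) => [|h he i]; first exact: Sg.
    by rewrite /shift -ze ?map_f// subgroup_valM subgroup_valV mulgA.
  - by move=> e; exists 0%R => // h _ i; rewrite !ffunE.
  - move=> a u v STu STv e.
    have [z Sz ze] := STu e; have [w Sw we] := STv e.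
    exists (a *: z + w)%R; first exact: Slin.
    by move=> h he i; rewrite !fctE !ffunE ze// we.
have [e eST] := HM _ _ STS.
exists [seq vH h * t i | h <- e, i <- enum 'I_r] => x xS.
suff STx : ST (fun h => [ffun i => x (vH h * t i)]).
  by move=> e'; have [z Sz ze] := STx e'; exists z => // h he i; rewrite ze// ffunE.
apply: eST => k; have [y Sy ys] := xS (vH k).
exists (fun h => [ffun i => y (vH h * t i)]).
  by move=> e'; exists y => // h _ i; rewrite ffunE.
move=> h he; apply/ffunP => i; rewrite /shift !ffunE ys.
  by rewrite /shift subgroup_valM subgroup_valV mulgA.
by apply: (allpairs_f (fun h i => vH h * t i)); rewrite ?mem_enum.
Qed.

(** With [t] running over representatives of all cosets, the strip is the whole of [G]. *)
Lemma linear_markov_type_finite_extension (nH : normal_subgroup H) :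
  linear_markov_type K (subgroup H) -> finite_group (quotient_group nH) ->
  linear_markov_type K G.
Proof.
move=> HM /finite_seqP[q qE]; apply/linear_markov_typeP => A S SS.
have [s sP] := linear_markov_strip_window
  (fun i => repr (tnth (in_tuple q) i)) HM SS.
exists s => x /sP xS; apply: linear_subshift_adherent => // l.
have dec g : exists p : subgroup H * 'I_(size q),
    g = vH p.1 * repr (tnth (in_tuple q) p.2).
  have : [set: quotient_group nH] (\pi g) by [].
  rewrite qE /= => /(tnthP (in_tuple q))[i gi].
  by have [|h gE] := @eq_quotg_val nH g (repr (tnth (in_tuple q) i));
    [rewrite reprK|exists (h, i)].
have [f fE] := choice dec.
have [z Sz ze] := xS [seq (f g).1 | g <- l].
exists z => // g gl.
by have := ze _ (map_f (fun g => (f g).1) gl) (f g).2; rewrite -fE.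
Qed.

(* [Y n] plays the role of the leading coefficient modules in Hilbert's basis *)
(* theorem; the layers [H t^i] may coincide, since [G/H] may be finite.       *)
Lemma linear_markov_type_cyclic_extension (nH : normal_subgroup H) :
  linear_markov_type K (subgroup H) -> cyclic_group (quotient_group nH) ->
  linear_markov_type K G.
Proof.
move=> HM [c cgen]; apply/linear_markov_typeP => A S SS.
have [_ Sg S0 Slin] := SS.
pose t := repr c.
have piX n : \pi_(quotient_group nH) (t ^+ n) = c ^+ n.
  elim: n => [|n IHn]; first by rewrite !expg0.
  by rewrite !expgS -IHn -[in RHS](reprK c); apply/esym; exact: pi_quotgM.
have dec g : exists h n, g = vH h * t ^+ n \/ g = vH h * t ^- n.
  have [n [gE|gE]] := cgen (\pi g).
    by have [|h ->] := @eq_quotg_val nH g (t ^+ n); [rewrite piX|exists h, n; left].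
  have [|h ->] := @eq_quotg_val nH g (t ^- n); last by exists h, n; right.
  by rewrite gE -piX; exact: pi_quotgV.
pose Y n := [set y : subgroup H -> A | forall e : seq (subgroup H),
  exists2 z, S z & {in e, forall h, z (vH h) = y h /\
    forall i, (0 < i <= n)%N -> z (vH h * t ^+ i) = 0%R}].
have YS n : linear_subshift (Y n).
  apply/linear_subshiftP; split.
  - move=> u au e; have [v Yv ve] := au e; have [z Sz ze] := Yv e.
    by exists z => // h he; rewrite -ve//; exact: ze.
  - move=> k u Yu e; have [z Sz ze] := Yu [seq k^-1 * h | h <- e].
    exists (shift (vH k) z) => [|h he]; first exact: Sg.
    have [z0 zi] := ze _ (map_f _ he).
    rewrite /shift -z0 subgroup_valM subgroup_valV; split=> // i /zi.
    by rewrite subgroup_valM subgroup_valV mulgA.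
  - by move=> e; exists 0%R.
  - move=> a u v Yu Yv e.
    have [z Sz ze] := Yu e; have [w Sw we] := Yv e.
    exists (a *: z + w)%R => [|h he]; first exact: Slin.
    have [z0 zi] := ze h he; have [w0 wi] := we h he.
    by rewrite !fctE z0 w0; split=> // i ni; rewrite zi// wi// scaler0 addr0.
have Ydec m n : (m <= n)%N -> Y n `<=` Y m.
  move=> mn y Yy e; have [z Sz ze] := Yy e; exists z => // h /ze[z0 zi].
  by split=> // i /andP[i0 im]; apply: zi; rewrite i0 (leq_trans im).
have [N YN] := linear_markov_dcc HM YS Ydec.
have [s sP] := linear_markov_strip_window (fun i : 'I_N.+1 => t ^+ i) HM SS.
exists s => x xS.
(* Induction on the width of the strip; all translates of [x] are treated together because the
   inductive step shifts by [t]. *)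
pose good m := forall g (e : seq (subgroup H)), exists2 z, S z &
  {in e, forall h i, (i <= m)%N -> z (vH h * t ^+ i) = shift g x (vH h * t ^+ i)}.
have goodN : good N.
  move=> g e; have [z Sz ze] := sP _ (window_shift xS g) e.
  by exists z => // h he i iN; exact: (ze h he (Ordinal (iN : i < N.+1)%N)).
have goodS m : (N <= m)%N -> good m -> good m.+1.
  move=> Nm goodm g; set x' := shift g x.
  (* Layers [1] to [m.+1] are the translate by [t] of layers [0] to [m]. Compactness yields one [z]
     valid on these whole layers, chosen before [e]. *)
  have [z Sz zx'] : exists2 z, S z &
      forall h i, (i <= m)%N -> z (vH h * t ^+ i.+1) = x' (vH h * t ^+ i.+1).
    have [] := @linear_compactness K A G (seq (subgroup H)) [::] (fun e =>
      S `&` [set z : G -> A | {in e, forall h i, (i <= m)%N ->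
        z (vH h * t ^+ i.+1) = x' (vH h * t ^+ i.+1)}]).
    - move=> e e'; exists (e ++ e') => z [Sz ze].
      by split; split=> // h he; apply: ze; rewrite mem_cat he ?orbT.
    - move=> e; have [f fE] := choice (normal_subgroup_swap nH t^-1).
      have [z Sz ze] := goodm (t^-1 * g) [seq f h | h <- e].
      exists (shift t z); split=> [|h he i im]; first exact: Sg.
      have hE : t^-1 * (vH h * t ^+ i.+1) = vH (f h) * t ^+ i.
        by rewrite mulgA fE expgS -mulgA mulKg.
      by rewrite /shift hE ze ?map_f// -hE shiftM /shift invgK mulVKg.
    - move=> e a y z w [Sy ye] [Sz ze] [Sw we]; split.
        exact: linear_subshift_affine.
      by move=> h he i im; rewrite !fctE ye// ze// we// subrr scaler0 add0r.
    move=> z az; exists z.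
      apply: linear_subshift_adherent => // l.
      by have [z' [Sz' _] zl] := az [::] l; exists z'.
    move=> h i im; have [z' [_ z'h] <-] := az [:: h] [:: vH h * t ^+ i.+1].
      by apply: z'h => //; exact: mem_head.
    exact: mem_head.
  pose w := (x' - z)%R.
  (* On finite parts of layers [0] to [N], [x'] agrees with some [z1] in [S], and [z1 - z] vanishes
     on the layers from [1] on because [N <= m]. *)
  have wY : Y N (fun h => w (vH h)).
    move=> e; have [z1 Sz1 z1e] := goodN g e.
    exists (z1 - z)%R => [|h he]; first exact: linear_subshiftB.
    have := z1e h he 0%N; rewrite expg0 mulg1 !fctE => ->//; split=> //.
    case=> // i /= iN; rewrite z1e// zx' ?subrr//.
    exact: leq_trans (ltnW iN) Nm.
  (* By stabilisation [z2] corrects layer [0] over [e] while vanishing on layers [1] to [m.+1]. *)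
  move=> e; have [z2 Sz2 z2e] := YN m.+1 _ wY e.
  exists (z + z2)%R => [|h /z2e[z20 z2i]]; first exact: linear_subshiftD.
  case=> [_|i im].
    by rewrite expg0 mulg1 !fctE z20 /w !fctE addrC subrK.
  by rewrite !fctE z2i ?addr0 ?zx'.
have good_all m : good (N + m)%N.
  elim: m => [|m IHm]; first by rewrite addn0.
  by rewrite addnS; apply: goodS; rewrite ?leq_addr.
(* The strips only involve nonnegative powers of [t], so a finite set is first pushed into one by a
   power of [t]. *)
have bounded (l : seq G) : exists a M, {in l, forall g, exists p,
    (p.2 <= M)%N /\ t ^+ a * g = vH p.1 * t ^+ p.2}.
  elim: l => [|g l [a [M IHl]]]; first by exists 0%N, 0%N.
  have [h [n gE]] := dec g.
  (* The new element lands in layer [n + a + n] or [a], according to the sign of its exponent; the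
     earlier ones move up by [n]. *)
  exists (n + a)%N, (n + a + n + M)%N => k; rewrite inE => /predU1P[->{k}|/IHl].
    have [h' hE] := normal_subgroup_swap nH (t ^+ (n + a)) h.
    case: gE => ->; rewrite mulgA hE.
      exists (h', (n + a + n)%N); split; first exact: leq_addr.
      by rewrite /= (expgnDr t (n + a)) mulgA.
    exists (h', a); split; first by rewrite /= -addnA -addnA addnCA leq_addr.
    by rewrite /= addnC expgnDr mulgA mulgK.
  move=> [[h' i] /= [iM kE]].
  have [h'' hE] := normal_subgroup_swap nH (t ^+ n) h'.
  exists (h'', (n + i)%N) => /=; split.
    by rewrite -addnA -addnA leq_add2l addnCA addnA -addnA (leq_trans iM)// addnA leq_addl.
  by rewrite expgnDr -mulgA kE mulgA hE -mulgA -expgnDr.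
apply: linear_subshift_adherent => // l.
have [a [M lM]] := bounded l.
have dec' g : exists p, g \in l -> (p.2 <= M)%N /\ t ^+ a * g = vH p.1 * t ^+ p.2.
  by have [/lM[p pE]|gl] := boolP (g \in l); [exists p|exists (1, 0%N)].
have [f fE] := choice dec'.
have [z Sz ze] := good_all M (t ^+ a) [seq (f g).1 | g <- l].
exists (shift (t ^- a) z) => [|g gl]; first exact: Sg.
have [iM gE] := fE g gl.
have := ze _ (map_f (fun g => (f g).1) gl) (f g).2 (leq_trans iM (leq_addl _ _)).
by rewrite -gE /shift invgK mulKg.
Qed.

(** * Passage to subgroups *)

Definition extend0 (A : vectType K) (u : subgroup H -> A) (g : G) : A :=
  if insub g is Some h then u h else 0%R.

Lemma extend0_val (A : vectType K) (u : subgroup H -> A) h :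
  extend0 u (vH h) = u h.
Proof. by rewrite /extend0 valK. Qed.

Lemma extend0_out (A : vectType K) (u : subgroup H -> A) g :
  g \notin H -> extend0 u g = 0%R.
Proof. by move=> gH; rewrite /extend0 insubN. Qed.

Lemma subgroup_memP g : reflect (exists h, g = vH h) (g \in H).
Proof.
apply: (iffP idP) => [gH|[h ->]]; last exact: valP.
by exists (exist (fun x => x \in H) _ gH).
Qed.

Lemma linear_markov_type_subgroup :
  linear_markov_type K G -> linear_markov_type K (subgroup H).
Proof.
move=> /linear_markov_typeP GM; apply/linear_markov_typeP => A S SS.
have [_ Sg S0 Slin] := SS.
pose SG := [set x : G -> A | forall g, S (fun h => x (g * vH h))].
have SGS : linear_subshift SG.
  apply/linear_subshiftP; split.
  - move=> x ax g; apply: linear_subshift_adherent => // e.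
    have [y SGy yx] := ax [seq g * vH h | h <- e].
    exists (fun h => y (g * vH h)) => // h he.
    by apply: yx; exact: (map_f (fun h => g * vH h)).
  - move=> k x SGx g; have := SGx (k^-1 * g).
    by congr S; apply/funext => h; rewrite /shift mulgA.
  - by move=> g.
  - by move=> a x y SGx SGy g; exact: Slin (SGx g) (SGy g).
have SG_ext u : S u -> SG (extend0 u).
  move=> Su g; have [/subgroup_memP[k ->]|gH] := boolP (g \in H).
    have := Sg k^-1 _ Su; congr S; apply/funext => h.
    by rewrite -subgroup_valM extend0_val /shift invgK.
  rewrite (_ : (fun _ => _) = 0%R)//; apply/funext => h.
  by rewrite extend0_out// gpredMr//; exact: valP.
have [s sSG] := GM _ _ SGS.
(* The points [g^-1 * d] and [g^-1 * d'] can both lie in [H] only if [d^-1 * d'] does; these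
   quotients form the window. *)
exists (pmap insub [seq d^-1 * d' | d <- s, d' <- s]) => x xS.
suff /(_ 1) : SG (extend0 x).
  by congr S; apply/funext => h; rewrite mul1g extend0_val.
apply: sSG => g.
have [[d ds dgH]|gs] := pselect (exists2 d, d \in s & d^-1 * g \in H); last first.
  (* Here the translated window misses [H], where alone [extend0 x] can be nonzero. *)
  exists 0%R; first by case: SGS.
  move=> d ds; rewrite /shift extend0_out//; apply/negP => gdH; apply: gs.
  by exists d => //; rewrite -gpredV invgM invgK.
have [k kE] := subgroup_memP _ dgH.
have [u Su ux] := xS k.
exists (shift d (extend0 u)); first by case: SGS => _ + _ _; apply; exact: SG_ext.
have gE : g = d * vH k by rewrite -kE mulVKg.
move=> d' d's; rewrite /shift gE invgM -mulgA -subgroup_valV.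
have [/subgroup_memP[h hE]|dd'H] := boolP (d^-1 * d' \in H).
  rewrite hE -subgroup_valM !extend0_val ux// mem_pmap.
  apply/mapP; exists (vH h); last by rewrite valK.
  by rewrite -hE; exact: (allpairs_f (fun d d' => d^-1 * d')).
by rewrite !extend0_out// gpredMl//; exact: valP.
Qed.

End Subgroup.

(** * Passage to quotients *)

Lemma linear_markov_type_quotient (K : fieldType) (G : groupType)
    (N : groupClosed G) (nN : normal_subgroup N) :
  linear_markov_type K G -> linear_markov_type K (quotient_group nN).
Proof.
set Q := quotient_group nN.
move=> /linear_markov_typeP GM; apply/linear_markov_typeP => A S SS.
have [_ Sg S0 Slin] := SS.
have piM g h : \pi_Q (g * h) = \pi_Q g * \pi_Q h by apply/esym; exact: pi_quotgM.
have piV g : \pi_Q g^-1 = (\pi_Q g)^-1 by apply/esym; exact: pi_quotgV.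
pose SG := [set x : G -> A | exists2 y, S y & x = fun g => y (\pi_Q g)].
have SGS : linear_subshift SG.
  apply/linear_subshiftP; split.
  - move=> x ax; exists (fun q => x (repr q)).
      apply: linear_subshift_adherent => // e.
      have [_ [y Sy ->] yx] := ax [seq repr q | q <- e].
      by exists y => // q qe; rewrite -yx ?map_f// reprK.
    (* Testing at [g] and at the representative of its class shows that the limit is constant on
       cosets. *)
    apply/funext => g; have [_ [y Sy ->] yx] := ax [:: g; repr (\pi_Q g)].
    by rewrite -!yx ?inE ?eqxx ?orbT// reprK.
  - move=> k _ [y Sy ->]; exists (shift (\pi_Q k) y); first exact: Sg.
    by apply/funext => g; rewrite /shift piM piV.
  - by exists 0%R.
  - move=> a _ _ [y Sy ->] [z Sz ->]; exists (a *: y + z)%R => //.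
    exact: Slin.
have [s sSG] := GM _ _ SGS.
exists [seq \pi_Q g | g <- s] => x xS.
have [|y Sy xy] := sSG (fun g => x (\pi_Q g)).
  move=> g; have [y Sy yx] := xS (\pi_Q g).
  exists (fun g => y (\pi_Q g)); first by exists y.
  by move=> h hs; rewrite yx ?map_f// /shift piM piV.
suff -> : x = y by [].
by apply/funext => q; rewrite -[q]reprK; exact: (congr1 (@^~ (repr q)) xy).
Qed.

Theorem proposition6p4 (K : fieldType) :
  [/\ (forall (G : groupType) (H : groupClosed G),
         linear_markov_type K G -> linear_markov_type K (subgroup H)),
      (forall (G : groupType) (N : groupClosed G) (nN : normal_subgroup N),
         linear_markov_type K G -> linear_markov_type K (quotient_group nN))
    & (forall (G : groupType) (H : groupClosed G) (nH : normal_subgroup H),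
         linear_markov_type K (subgroup H) ->
         finite_group (quotient_group nH) \/ cyclic_group (quotient_group nH) ->
         linear_markov_type K G)].
Proof.
split=> [G H|G N nN|G H nH HM [fQ|cQ]].
- exact: linear_markov_type_subgroup.
- exact: linear_markov_type_quotient.
- exact: linear_markov_type_finite_extension HM fQ.
- exact: linear_markov_type_cyclic_extension HM cQ.
Qed.
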